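(* Let $\mathbb X=\langle X;g,\le,\mathcal T\rangle$ be a finite one-generated Ockham space, with generator $0$ (i.e. $X=\{g^k(0)\mid k\ge 0\}$), and assume that $g$ is order-preserving. Let $\mathbf A=K(\mathbb X)$ be the Ockham algebra dual to $\mathbb X$, with underlying set $A$ the set of all order-preserving maps from $\langle X;\le\rangle$ to the two-element chain $\{0,1\}$, and define the alter ego $\mathbb A=\langle A;u,\preccurlyeq,\mathcal T\rangle$ of $\mathbf A$, where $\mathcal T$ is the discrete topology on $A$ and - $u=K(g)$ is the endomorphism of $\mathbf A$ given by $u(\alpha)=\alpha\circ g$, and - $\preccurlyeq$ is the alternating order on $A$: $\alpha\preccurlyeq\beta$ if and only if $\alpha(g^k(0))\le\beta(g^k(0))$ for all even $k\ge0$, and $\alpha(g^k(0))\ge\beta(g^k(0))$ for all odd $k\ge1$. Then $\mathbb A$ yields a strong duality on the variety $\operatorname{Var}(\mathbf A)$ generated by $\mathbf A$, and so the following interpolation condition holds: for all $n\ge1$ and all substructures $\mathbb Z\le\mathbb A^n$, every morphism $\alpha\colon\mathbb Z\to\mathbb A$ extends to an $n$-ary term function of the algebra $\mathbf A$.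
   Context: An Ockham algebra $\langle A;\vee,\wedge,f,0,1\rangle$ is a bounded distributive lattice with a unary operation $f$ satisfying $f(0)=1$, $f(1)=0$, $f(x\vee y)=f(x)\wedge f(y)$, $f(x\wedge y)=f(x)\vee f(y)$. A finite Ockham space is a finite ordered set (with discrete topology) equipped with an order-reversing self-map $g$. For a finite Ockham space $\mathbb X$, the Ockham algebra $K(\mathbb X)$ consists of all order-preserving maps $\alpha\colon\langle X;\le\rangle\to\{0,1\}$ (with $0<1$), with pointwise lattice operations and bounds, and $f(\alpha)=(\alpha\circ g)'$, where $'$ is Boolean complement on $\{0,1\}$. An alter ego of a finite algebra $\mathbf A$ is a (discretely topologised) structure on the set $A$ whose (total or partial) operations have graphs compatible with $\mathbf A$ and whose relations are compatible with $\mathbf A$ (a compatible relation being a non-empty subuniverse of a finite power of $\mathbf A$). Morphisms between structures of the type of $\mathbb A$ are continuous maps preserving $u$ and $\preccurlyeq$; embeddings are morphisms that are isomorphisms onto closed substructures (with induced operation, relation and topology). Let $\mathcal X$ be the class $\mathsf{IS_cP^+}(\mathbb A)$ of all isomorphic copies of topologically closed (possibly empty) substructures of non-zero powers of $\mathbb A$ (with the product topology). For an algebra $\mathbf B\in\operatorname{Var}(\mathbf A)$, let $D(\mathbf B)$ be the set of homomorphisms $\mathbf B\to\mathbf A$, viewed as a closed substructure of $\mathbb A^B$; for $\mathbb Z\in\mathcal X$, let $E(\mathbb Z)$ be the set of morphisms $\mathbb Z\to\mathbb A$, viewed as a subalgebra of $\mathbf A^Z$. The alter ego $\mathbb A$ yields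 a duality on $\operatorname{Var}(\mathbf A)$ if for each $\mathbf B\in\operatorname{Var}(\mathbf A)$ the evaluation map $\mathbf B\to ED(\mathbf B)$, $b\mapsto(x\mapsto x(b))$, is an isomorphism. The duality is full if moreover, for each $\mathbb Z\in\mathcal X$, the evaluation map $\mathbb Z\to DE(\mathbb Z)$, $z\mapsto(\alpha\mapsto\alpha(z))$, is an isomorphism. It is strong if it is full and $\mathbb A$ is injective in $\mathcal X$ with respect to embeddings. *)

(* Defs.v *)
From HB Require Import structures.
From mathcomp Require Import all_boot all_order.
From mathcomp Require Import all_classical topology.

Set Implicit Arguments.
Unset Strict Implicit.
Unset Printing Implicit Defensive.

Import Order.Theory.
Local Open Scope classical_set_scope.
Local Open Scope order_scope.

HB.mixin Record isOckhamAlgebra d T of Order.TBDistrLattice d T := {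
  ock : T -> T;
  ock0 : ock \bot = \top;
  ock1 : ock \top = \bot;
  ockU : forall x y : T, ock (x `|` y) = ock x `&` ock y;
  ockI : forall x y : T, ock (x `&` y) = ock x `|` ock y
}.

#[short(type="ockhamType")]
HB.structure Definition OckhamAlgebra d :=
  { T of Order.TBDistrLattice d T & isOckhamAlgebra d T }.

Definition ockham_hom d (B : ockhamType d) d' (C : ockhamType d')
    (h : B -> C) : Prop :=
  [/\ Order.join_morphism h, Order.meet_morphism h, h \bot = \bot,
      h \top = \top & {morph h : x / ock x}].

Definition ockham_iso d (B : ockhamType d) d' (C : ockhamType d')
    (h : B -> C) : Prop :=
  ockham_hom h /\ bijective h.

(** [boolp] already provides the pointwise lattice structure on [I -> B]. *)
Section PowerLattice.
Context (I : Type) d (B : tbDistrLatticeType d).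
Implicit Types a : I -> B.

Fact pow_meetUl :
  @left_distributive (I -> B) (I -> B) Order.meet Order.join.
Proof. by move=> a b c; apply/funext => i; exact: meetUl. Qed.

HB.instance Definition _ :=
  Order.Lattice_Meet_isDistrLattice.Build _ (I -> B) pow_meetUl.

Fact pow_le0 a : (fun=> \bot : B) <= a.
Proof. by apply/lefP => i; exact: le0x. Qed.

HB.instance Definition _ := Order.hasBottom.Build _ (I -> B) pow_le0.

Fact pow_le1 a : a <= (fun=> \top : B).
Proof. by apply/lefP => i; exact: lex1. Qed.

HB.instance Definition _ := Order.hasTop.Build _ (I -> B) pow_le1.

End PowerLattice.

Section Power.
Context (I : Type) d (B : ockhamType d).
Implicit Types a b c : I -> B.

Definition pow_ock a : I -> B := fun i => ock (a i).

Fact pow_ock0 : pow_ock \bot = \top.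
Proof. by apply/funext => i; exact: ock0. Qed.
Fact pow_ock1 : pow_ock \top = \bot.
Proof. by apply/funext => i; exact: ock1. Qed.
Fact pow_ockU a b : pow_ock (a `|` b) = pow_ock a `&` pow_ock b.
Proof. by apply/funext => i; exact: ockU. Qed.
Fact pow_ockI a b : pow_ock (a `&` b) = pow_ock a `|` pow_ock b.
Proof. by apply/funext => i; exact: ockI. Qed.

HB.instance Definition _ := isOckhamAlgebra.Build _ (I -> B)
  pow_ock0 pow_ock1 pow_ockU pow_ockI.

End Power.

(** Since [\bot] and [\top] are in the signature, a subuniverse is nonempty. *)
Definition subuniverse d (B : ockhamType d) (S : set B) : Prop :=
  [/\ forall a b, S a -> S b -> S (a `|` b),
      forall a b, S a -> S b -> S (a `&` b),
      S \bot, S \top & forall a, S a -> S (ock a)].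

Definition subalg d (B : ockhamType d) (S : set B) of subuniverse S : Type :=
  set_type S.

Section Subalgebra.
Context d (B : ockhamType d) (S : set B) (hS : subuniverse S).
Local Notation U := (subalg hS).

HB.instance Definition _ := SubChoice.on U.

Fact subalg_meet_closed : {in S &, forall a b, a `&` b \in S}.
Proof.
by move=> a b /set_mem Sa /set_mem Sb; apply/mem_set; case: hS => _ + _ _ _; exact.
Qed.
Fact subalg_join_closed : {in S &, forall a b, a `|` b \in S}.
Proof.
by move=> a b /set_mem Sa /set_mem Sb; apply/mem_set; case: hS => + _ _ _ _; exact.
Qed.
Fact subalg_bot : \bot \in S.
Proof. by apply/mem_set; case: hS. Qed.
Fact subalg_top : \top \in S.
Proof. by apply/mem_set; case: hS. Qed.

HB.instance Definition _ := Order.SubChoice_isTBSubLattice.Build d B (mem S) d U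
  subalg_meet_closed subalg_join_closed subalg_bot subalg_top.

Fact subalg_meetUl : @left_distributive U U Order.meet Order.join.
Proof.
by move=> a b c; apply: eq_sig_hprop => //; exact: meetUl.
Qed.

HB.instance Definition _ :=
  Order.Lattice_Meet_isDistrLattice.Build d U subalg_meetUl.

Definition subalg_ock (a : U) : U :=
  exist _ (ock (val a)) (mem_set (match hS with
    And5 _ _ _ _ ock_closed => ock_closed _ (set_mem (valP a)) end)).

Fact subalg_ock0 : subalg_ock \bot = \top.
Proof. by apply: eq_sig_hprop => //; exact: ock0. Qed.
Fact subalg_ock1 : subalg_ock \top = \bot.
Proof. by apply: eq_sig_hprop => //; exact: ock1. Qed.
Fact subalg_ockU a b : subalg_ock (a `|` b) = subalg_ock a `&` subalg_ock b.
Proof. by apply: eq_sig_hprop => //; exact: ockU. Qed.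
Fact subalg_ockI a b : subalg_ock (a `&` b) = subalg_ock a `|` subalg_ock b.
Proof. by apply: eq_sig_hprop => //; exact: ockI. Qed.

HB.instance Definition _ := isOckhamAlgebra.Build d U
  subalg_ock0 subalg_ock1 subalg_ockU subalg_ockI.

End Subalgebra.

(** The smallest class containing [A] and closed under homomorphic images,
    subalgebras and products, up to isomorphism. A product of the family [F]
    is given through its projections. *)
Inductive variety d (A : ockhamType d) :
    forall d', ockhamType d' -> Prop :=
| variety_gen : variety A A
| variety_H d1 (B : ockhamType d1) d2 (C : ockhamType d2) (h : B -> C) :
    ockham_hom h -> (forall c, exists b, h b = c) ->
    variety A B -> variety A C
| variety_S d1 (B : ockhamType d1) d2 (C : ockhamType d2) (h : C -> B) :
    ockham_hom h -> injective h -> variety A B -> variety A C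
| variety_P (I : Type) (dF : I -> Order.disp_t) (F : forall i, ockhamType (dF i))
    d' (C : ockhamType d') (p : forall i, C -> F i) :
    (forall i, ockham_hom (p i)) -> bijective (fun c i => p i c) ->
    (forall i, variety A (F i)) -> variety A C.

Inductive term (n : nat) : Type :=
| TVar of 'I_n
| TJoin of term n & term n
| TMeet of term n & term n
| TOck of term n
| TBot
| TTop.

Fixpoint term_fun n d (A : ockhamType d) (t : term n) (x : 'I_n -> A) : A :=
  match t with
  | TVar i => x i
  | TJoin s t => term_fun s x `|` term_fun t x
  | TMeet s t => term_fun s x `&` term_fun t x
  | TOck t => ock (term_fun t x)
  | TBot => \bot
  | TTop => \top
  end.

Record tstruct := TStruct {
  tcarrier :> topologicalType;
  sop : tcarrier -> tcarrier;
  srel : tcarrier -> tcarrier -> Prop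
}.

Definition morphism (Y Z : tstruct) (phi : Y -> Z) : Prop :=
  [/\ continuous phi, {morph phi : y / sop y}
    & forall y y', srel y y' -> srel (phi y) (phi y')].

Definition struct_iso (Y Z : tstruct) (phi : Y -> Z) : Prop :=
  morphism phi /\
  exists psi : Z -> Y, [/\ morphism psi, cancel phi psi & cancel psi phi].

Definition power (S : Type) (Y : tstruct) : tstruct :=
  @TStruct {ptws S -> Y} (fun y s => sop (y s))
    (fun y y' => forall s, srel (y s) (y' s)).

Definition sop_closed (Y : tstruct) (Z : set Y) : Prop :=
  forall y, Z y -> Z (sop y).

Definition substruct (Y : tstruct) (Z : set Y) (hZ : sop_closed Z) : tstruct :=
  @TStruct (set_type Z)
    (fun z => exist _ (sop (val z)) (mem_set (hZ _ (set_mem (valP z)))))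
    (fun z z' => srel (val z) (val z')).

Definition embedding (Y Z : tstruct) (phi : Y -> Z) : Prop :=
  morphism phi /\
  exists (W : set Z) (hW : sop_closed W) (psi : Y -> substruct hW),
    [/\ closed W, struct_iso psi & forall y, phi y = val (psi y)].

Definition IScP (M Z : tstruct) : Prop :=
  exists (S : Type) (W : set (power S M)) (hW : sop_closed W)
         (phi : Z -> substruct hW),
    [/\ inhabited S, closed W & struct_iso phi].

Definition compatible d (A : ockhamType d) n (R : set ('I_n -> A)) : Prop :=
  R !=set0 /\ subuniverse R.

(** Alter egos of the type used here: one total unary operation, one binary
    relation and the discrete topology. *)
Record alter_ego d (A : ockhamType d) := AlterEgo {
  ae_op : A -> A;
  ae_rel : A -> A -> Prop;
  ae_op_compatible :
    compatible [set p : 'I_2 -> A | ae_op (p ord0) = p ord_max];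
  ae_rel_compatible :
    compatible [set p : 'I_2 -> A | ae_rel (p ord0) (p ord_max)]
}.

Definition ae_struct d (A : ockhamType d) (M : alter_ego A) : tstruct :=
  @TStruct (discrete_topology A) (ae_op M) (ae_rel M).

Coercion ae_struct : alter_ego >-> tstruct.

Section Duality.
Context d (A : ockhamType d) (M : alter_ego A).

Lemma ae_op_hom : ockham_hom (ae_op M).
Proof.
case: (ae_op_compatible M) => _ [hU hI h0 h1 hf].
pose p a (i : 'I_2) := if i == ord0 then a else ae_op M a.
have pP a : ae_op M (p a ord0) = p a ord_max by [].
split=> [a b|a b|||a]; [exact: hU (pP a) (pP b)|exact: hI (pP a) (pP b)|..] => //.
exact: hf (pP a).
Qed.

Lemma ae_relP : [/\
  forall a b a' b', ae_rel M a b -> ae_rel M a' b' ->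
    ae_rel M (a `|` a') (b `|` b'),
  forall a b a' b', ae_rel M a b -> ae_rel M a' b' ->
    ae_rel M (a `&` a') (b `&` b'),
  ae_rel M \bot \bot, ae_rel M \top \top
  & forall a b, ae_rel M a b -> ae_rel M (ock a) (ock b)].
Proof.
case: (ae_rel_compatible M) => _ [hU hI h0 h1 hf].
pose p a b (i : 'I_2) : A := if i == ord0 then a else b.
split=> // [a b a' b' r r'|a b a' b' r r'|a b r].
- exact: (hU (p a b) (p a' b') r r').
- exact: (hI (p a b) (p a' b') r r').
- exact: (hf (p a b) r).
Qed.

Section DualOfAlgebra.
Context d' (B : ockhamType d').

Definition homs : set (power B M) := [set x : B -> A | ockham_hom x].

Fact homs_sop_closed : sop_closed homs.
Proof.
move=> x [xU xI x0 x1 xf]; have [uU uI u0 u1 uf] := ae_op_hom.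
split=> [a b|a b|||a] /=.
- by rewrite xU uU.
- by rewrite xI uI.
- by rewrite x0 u0.
- by rewrite x1 u1.
- by rewrite xf uf.
Qed.

Definition dual_struct : tstruct := substruct homs_sop_closed.

End DualOfAlgebra.

Section DualOfStructure.
Context (Z : tstruct).

Definition morphisms : set (Z -> A) := [set alpha : Z -> M | morphism alpha].

Fact continuous_to_ae (alpha : Z -> M) :
  continuous alpha <-> forall z, \forall w \near z, alpha w = alpha z.
Proof.
split=> [c z|c z].
  by apply: (c z [set a | a = alpha z]); exact: discrete_set1.
by apply/discrete_cvg; exact: c.
Qed.

Fact morphisms_subuniverse : subuniverse morphisms.
Proof.
have [uU uI u0 u1 uf] := ae_op_hom; have [rU rI r0 r1 rf] := ae_relP.
split=> [a b [/continuous_to_ae ca ua ra] [/continuous_to_ae cb ub rb]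
        |a b [/continuous_to_ae ca ua ra] [/continuous_to_ae cb ub rb]
        |||a [/continuous_to_ae ca ua ra]].
- split.
  + apply/continuous_to_ae => z; apply: filterS2 (ca z) (cb z) => w ew ew'.
    by rewrite /= !joinfE ew ew'.
  + by move=> z; rewrite !joinfE ua ub /= uU.
  + by move=> z z' rz; apply: rU; [exact: ra|exact: rb].
- split.
  + apply/continuous_to_ae => z; apply: filterS2 (ca z) (cb z) => w ew ew'.
    by rewrite /= !meetfE ew ew'.
  + by move=> z; rewrite !meetfE ua ub /= uI.
  + by move=> z z' rz; apply: rI; [exact: ra|exact: rb].
- split=> //; first by apply/continuous_to_ae => z; exact: nearW.
- split=> //; first by apply/continuous_to_ae => z; exact: nearW.
- split.
  + apply/continuous_to_ae => z; apply: filterS (ca z) => w ew.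
    by congr ock.
  + by move=> z; rewrite /= -[RHS]/(ae_op M (ock (a z))) uf; congr ock; exact: ua.
  + by move=> z z' rz; apply: rf; exact: ra.
Qed.

Definition dual_algebra : ockhamType _ := subalg morphisms_subuniverse.

End DualOfStructure.

Fact eval_algebra_subproof d' (B : ockhamType d') (b : B) :
  (fun x : dual_struct B => val x b) \in @morphisms (dual_struct B).
Proof.
apply/mem_set; split=> [x| //|x y rxy]; last exact: rxy.
have cv : {for x, continuous (val : dual_struct B -> power B M)}.
  exact: initial_continuous.
have cp : {for val x, continuous (proj b : power B M -> M)}.
  exact: proj_continuous.
exact: continuous_comp cv cp.
Qed.

Definition eval_algebra d' (B : ockhamType d') (b : B) :
    dual_algebra (dual_struct B) :=
  exist (fun h => h \in @morphisms (dual_struct B)) _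
    (eval_algebra_subproof b).

Fact eval_struct_subproof (Z : tstruct) (z : Z) :
  (fun alpha : dual_algebra Z => sval alpha z) \in @homs _ (dual_algebra Z).
Proof. exact/mem_set. Qed.

Definition eval_struct (Z : tstruct) (z : Z) : dual_struct (dual_algebra Z) :=
  exist (fun h => h \in @homs _ (dual_algebra Z)) _ (eval_struct_subproof z).

Definition yields_duality : Prop :=
  forall d' (B : ockhamType d'), variety A B -> ockham_iso (@eval_algebra _ B).

Definition yields_full_duality : Prop :=
  yields_duality /\
  forall Z : tstruct, IScP M Z -> struct_iso (@eval_struct Z).

Definition injective_in_IScP : Prop :=
  forall Y Z : tstruct, IScP M Y -> IScP M Z ->
  forall (phi : Y -> Z) (alpha : Y -> M), embedding phi -> morphism alpha ->
  exists beta : Z -> M, morphism beta /\ forall y, beta (phi y) = alpha y.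

Definition yields_strong_duality : Prop :=
  yields_full_duality /\ injective_in_IScP.

Definition interpolation : Prop :=
  forall n, (1 <= n)%N ->
  forall (Z : set (power 'I_n M)) (hZ : sop_closed Z)
    (alpha : substruct hZ -> M), morphism alpha ->
  exists t : term n, forall z, alpha z = term_fun t (val z : 'I_n -> A).

End Duality.

(** The topology of a finite Ockham space is discrete, hence omitted. *)
HB.mixin Record isOckhamSpace d X of Order.FinPOrder d X := {
  og : X -> X;
  og_anti : forall x y : X, x <= y -> og y <= og x
}.

#[short(type="finOckhamSpaceType")]
HB.structure Definition FinOckhamSpace d :=
  { X of Order.FinPOrder d X & isOckhamSpace d X }.

Section K.
Context d (X : finOckhamSpaceType d).

Definition order_preserving : set (X -> bool) :=
  [set alpha | {homo alpha : x y / x <= y}].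

Definition K : Type := set_type order_preserving.

HB.instance Definition _ := SubChoice.on K.

Fact K_meet_closed :
  {in mem order_preserving &, forall a b, a `&` b \in mem order_preserving}.
Proof.
move=> a b /set_mem ha /set_mem hb; apply/mem_set => x y xy.
by rewrite !meetfE; apply: leI2; [exact: ha|exact: hb].
Qed.
Fact K_join_closed :
  {in mem order_preserving &, forall a b, a `|` b \in mem order_preserving}.
Proof.
move=> a b /set_mem ha /set_mem hb; apply/mem_set => x y xy.
by rewrite !joinfE; apply: leU2; [exact: ha|exact: hb].
Qed.
Fact K_bot : \bot \in mem order_preserving.
Proof. exact/mem_set. Qed.
Fact K_top : \top \in mem order_preserving.
Proof. exact/mem_set. Qed.

HB.instance Definition _ := Order.SubChoice_isTBSubLattice.Build
  _ (X -> bool) (mem order_preserving) FunOrder.fun_display K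
  K_meet_closed K_join_closed K_bot K_top.

Fact K_meetUl : @left_distributive K K Order.meet Order.join.
Proof. by move=> a b c; apply: eq_sig_hprop => //; exact: meetUl. Qed.

HB.instance Definition _ :=
  Order.Lattice_Meet_isDistrLattice.Build _ K K_meetUl.

Fact K_ock_subproof (a : K) :
  (fun x => ~~ (val a (og x))) \in order_preserving.
Proof.
apply/mem_set => x y xy; have := set_mem (valP a) _ _ (og_anti _ _ xy).
by rewrite !leEbool; case: (val a (og x)); case: (val a (og y)).
Qed.

Definition K_ock (a : K) : K :=
  exist (fun h => h \in order_preserving) _ (K_ock_subproof a).

Fact K_ock0 : K_ock \bot = \top.
Proof. by apply: eq_sig_hprop => //; apply/funext. Qed.
Fact K_ock1 : K_ock \top = \bot.
Proof. by apply: eq_sig_hprop => //; apply/funext. Qed.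
Fact K_ockU a b : K_ock (a `|` b) = K_ock a `&` K_ock b.
Proof. by apply: eq_sig_hprop => //; apply/funext => x; exact: negb_or. Qed.
Fact K_ockI a b : K_ock (a `&` b) = K_ock a `|` K_ock b.
Proof. by apply: eq_sig_hprop => //; apply/funext => x; exact: negb_and. Qed.

HB.instance Definition _ := isOckhamAlgebra.Build _ K
  K_ock0 K_ock1 K_ockU K_ockI.

Context (x0 : X) (og_homo : {homo @og d X : x y / x <= y}).

Fact K_u_subproof (a : K) : (fun x => val a (og x)) \in order_preserving.
Proof. by apply/mem_set => x y /og_homo; exact: set_mem (valP a) _ _. Qed.

Definition K_u (a : K) : K :=
  exist (fun h => h \in order_preserving) _ (K_u_subproof a).

Definition alternating (a b : K) : Prop := forall k,
  (~~ odd k -> val a (iter k og x0) <= val b (iter k og x0)) /\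
  (odd k -> val b (iter k og x0) <= val a (iter k og x0)).

Fact K_u_compatible :
  compatible [set p : 'I_2 -> K | K_u (p ord0) = p ord_max].
Proof.
suff S : subuniverse [set p : 'I_2 -> K | K_u (p ord0) = p ord_max].
  by split=> //; exists \bot; case: S.
by split=> [a b pa pb|a b pa pb|||a pa] /=; apply: eq_sig_hprop => //=;
  rewrite ?/(ock _) /= /pow_ock -?pa -?pb.
Qed.

Fact alternating_compatible :
  compatible [set p : 'I_2 -> K | alternating (p ord0) (p ord_max)].
Proof.
suff S : subuniverse [set p : 'I_2 -> K | alternating (p ord0) (p ord_max)].
  by split=> //; exists \bot; case: S.
split=> [a b pa pb k|a b pa pb k|//|//|a pa k].
- have [ea oa] := pa k; have [eb ob] := pb k.
  by split=> hk; apply: leU2; [exact: ea|exact: eb|exact: oa|exact: ob].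
- have [ea oa] := pa k; have [eb ob] := pb k.
  by split=> hk; apply: leI2; [exact: ea|exact: eb|exact: oa|exact: ob].
- have [] := pa k.+1; rewrite /= negbK => ea oa.
  by split=> [/oa|/ea]; rewrite !leEbool /=; do 2!case: (val _ _).
Qed.

Definition K_alter_ego : alter_ego K :=
  AlterEgo K_u_compatible alternating_compatible.

End K.

(* Main.v *)
Require Import Defs.
From mathcomp Require Import all_boot all_order.
From mathcomp Require Import all_classical topology.

Set Implicit Arguments.
Unset Strict Implicit.
Unset Printing Implicit Defensive.

Import Order.Theory.
Local Open Scope classical_set_scope.
Local Open Scope order_scope.

(** The theorem is Priestley duality in disguise. An element [a] of [K X] is
    determined by its values at the points g^k(x0), and the value there is the
    value at [x0] of u^k(a), and also, up to a negation when k is odd, the value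
    at [x0] of f^k(a). By the first reading a map into [K X] that commutes with
    [u] is determined by its composite with evaluation at [x0]
    ([morphism_ext]); by the second so is a homomorphism into [K X]
    ([hom_ext]), and the alternating order says that every f^k(a) is below
    f^k(b) at [x0] ([alternatingP]). So E(Z) is a lattice of clopen up-sets of
    Z, and D(B) is a space of lattice homomorphisms from B to the two-element
    lattice.

    For B in the variety, D(B) contains all these lattice homomorphisms
    ([lift_hom]). To rebuild a map into [K X] from a two-valued [y], its value
    at g^k(x0) has to be y(f^k(b)), negated when k is odd. This is well defined
    and order-preserving on X as soon as each comparison of g^k(x0) with
    g^l(x0) yields an inequality between f^k and f^l. The inequality holds in
    [K X] because every power of g preserves the order ([K_order_identity]), and
    as it is an identity it holds in the whole variety. With the prime filter
    theorem, B embeds in ED(B).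

    Three surjectivity statements come from one theorem of Stone-Weierstrass
    type, [separating_subuniverse]: on a compact structure, an algebra of
    morphisms into the alter ego that is rich enough to detect the relation
    contains every morphism. The algebra of evaluation maps on D(B) gives the
    duality, the algebra of restrictions along an embedding gives injectivity,
    and the algebra of term functions gives interpolation.

    For fullness, the coordinates of a structure Z in the class already make
    Z -> DE(Z) an isomorphism onto its image. It is onto because a homomorphism
    E(Z) -> A prescribes the values at [x0] of all morphisms, any finite part of
    the prescription is met at some point of Z, and Z is compact
    ([eval_struct_surj]). *)

(** * Prime filters of bounded distributive lattices *)

Section PrimeFilters.
Context d (B : tbDistrLatticeType d).

Definition two_hom (y : B -> bool) : Prop :=
  [/\ {morph y : a b / a `|` b >-> a || b},
      {morph y : a b / a `&` b >-> a && b}, y \bot = false & y \top = true].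

(** A filter maximal among those that contain [a] and avoid [b] is prime, so its
    characteristic function is a lattice homomorphism. *)
Lemma prime_filter (a b : B) : ~~ (a <= b) ->
  exists y, [/\ two_hom y, y a = true & y b = false].
Proof.
move=> nab.
(* The empty set is admitted because the union of an empty chain must be. *)
pose P (F : set B) := [/\ forall x y, F x -> F y -> F (x `&` y),
  forall x y, x <= y -> F x -> F y, ~ F b & F !=set0 -> F a].
have [F chainF totF|F [[FI Fup Fb Fa] Fmax]] := @Zorn_bigcup B P.
  split.
  - move=> x y [G FG Gx] [H FH Hy].
    have [GH|HG] := totF _ _ FG FH.
      by exists H => //; have [HI _ _ _] := chainF _ FH; exact/HI/Hy/GH.
    by exists G => //; have [GI _ _ _] := chainF _ FG; apply: GI Gx _; exact: HG.
  - move=> x y xy [G FG Gx]; exists G => //.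
    by have [_ Gup _ _] := chainF _ FG; exact: Gup xy Gx.
  - by move=> [G FG]; have [_ _ + _] := chainF _ FG.
  - move=> [x [G FG Gx]]; exists G => //.
    by have [_ _ _] := chainF _ FG; apply; exists x.
have {}Fa : F a.
  apply: contrapT => nFa; apply: (Fmax [set x | a <= x]).
    split; last by move=> /(_ a (lexx a)).
    by move=> x Fx; case: nFa; apply: Fa; exists x.
  split=> [x y /= ax ay|x y xy /= ax||_] /=; last exact: lexx.
  - by rewrite lexI ax.
  - exact: le_trans ax xy.
  - exact/negP.
(* By maximality, F together with an element outside it generates b. *)
have out c : ~ F c -> exists2 f, F f & f `&` c <= b.
  move=> nFc; apply: contrapT => nf.
  apply: (Fmax [set x | exists2 f, F f & f `&` c <= x]).
    split; first by move=> x Fx; exists x => //; exact: leIl.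
    by move=> sub; apply/nFc/sub; exists a => //; exact: leIr.
  split=> [x y [f Ff fx] [g Fg gy]|x y xy [f Ff fx]||_].
  - exists (f `&` g); first exact: FI.
    rewrite lexI (le_trans _ fx) ?(le_trans _ gy) //.
      by rewrite leI2 // leIr.
    by rewrite leI2 // leIl.
  - by exists f => //; exact: le_trans fx xy.
  - by move=> [f Ff fb]; apply: nf; exists f.
  - by exists a => //; exact: leIl.
exists (fun x => `[< F x >]); split; last 2 first.
- exact/asboolP.
- exact/asboolPn.
split=> [x y|x y||].
- apply/idP/idP; last first.
    by case/orP => /asboolP Fx; apply/asboolP; apply: Fup Fx; rewrite ?leUl ?leUr.
  move=> /asboolP Fxy; apply/negPn/negP; rewrite negb_or => /andP[].
  move=> /asboolPn/out[f Ff fx] /asboolPn/out[g Fg gy]; apply: Fb.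
  apply: (Fup ((f `&` g) `&` (x `|` y))); last exact: FI (FI _ _ Ff Fg) Fxy.
  rewrite meetUr leUx (le_trans _ fx) ?(le_trans _ gy) //.
    by rewrite leI2 // leIr.
  by rewrite leI2 // leIl.
- apply/asboolP/andP => [Fxy|[/asboolP Fx /asboolP Fy]]; last exact: FI.
  by split; apply/asboolP; apply: Fup Fxy; rewrite ?leIl ?leIr.
- by apply/asboolPn => F0; apply: Fb; apply: Fup F0; exact: le0x.
- by apply/asboolP; apply: Fup Fa; exact: lex1.
Qed.

End PrimeFilters.

(** * Compactness *)

Section Compactness.

Lemma compact_filter_base (Z : topologicalType) (I : Type) (P : set I)
    (C : I -> set Z) :
  compact [set: Z] -> P !=set0 ->
  (forall i, P i -> closed (C i) /\ C i !=set0) ->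
  (forall i j, P i -> P j -> exists2 k, P k & C k `<=` C i `&` C j) ->
  exists z, forall i, P i -> C i z.
Proof.
move=> cZ P0 CP CI.
have FF : Filter (filter_from P C) by exact: filter_from_filter.
have PF : ProperFilter (filter_from P C).
  by apply: filter_from_proper => i /CP[].
have [|z [_ zC]] := cZ (filter_from P C) PF; first exact: filterT.
exists z => i Pi; have [clC _] := CP i Pi; apply: (clC z) => B Bz.
by apply: zC => //; exists i.
Qed.

Lemma continuous_pointwise (S : Type) (X Y : topologicalType)
    (f : X -> {ptws S -> Y}) :
  (forall s, continuous (fun x => f x s)) -> continuous f.
Proof.
move=> fs x; apply/cvg_sup => s.
exact: (@continuous_comp_initial _ _ _ (fun g : S -> Y => g s) f (fs s) x).
Qed.

Lemma continuous_coord (S : Type) (Y : topologicalType) (s : S) :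
  continuous (fun f : {ptws S -> Y} => f s).
Proof. exact: (@proj_continuous {classic S} (fun=> Y) s). Qed.

Lemma compact_power (S : Type) (Y : topologicalType) :
  compact [set: Y] -> compact [set: {ptws S -> Y}].
Proof.
move=> cY; have := @tychonoff {classic S} (fun=> Y) (fun=> setT) (fun=> cY).
by congr compact; apply/seteqP; split.
Qed.

Lemma compact_subspace (T : topologicalType) (W : set T) :
  compact W -> compact [set: set_type W].
Proof.
move=> cW F PF _.
have [|w [Ww wF]] := cW (fmap (val : set_type W -> T) F) _.
  apply: (@filterS _ F _ setT) (@filterT _ F _) => z _ /=.
  exact: set_mem (valP z).
exists (exist _ w (mem_set Ww)); split => // A B FA [_ [[V oV <-] /= Vw VB]].
have [_ [[z Az <-] Vz]] : (val @` A) `&` V !=set0.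
  apply: wF; last exact: open_nbhs_nbhs.
  by apply: (@filterS _ F _ A) FA => z Az; exists z.
by exists z; split => //; exact: VB.
Qed.

End Compactness.

(** * Identities in varieties *)

Section Identities.

Lemma hom_term_fun d (B : ockhamType d) d' (C : ockhamType d') (h : B -> C)
    n (t : term n) (x : 'I_n -> B) :
  ockham_hom h -> h (term_fun t x) = term_fun t (h \o x).
Proof.
move=> [hU hI h0 h1 hf].
by elim: t => //= [s <- t <-|s <- t <-|t <-]; rewrite ?hU ?hI ?hf.
Qed.

Lemma variety_identity d (A : ockhamType d) n (s t : term n) :
  (forall x : 'I_n -> A, term_fun s x = term_fun t x) ->
  forall d' (B : ockhamType d'), variety A B ->
  forall x : 'I_n -> B, term_fun s x = term_fun t x.
Proof.
move=> Ast d' B; elim=> {d' B} //.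
- move=> d1 B d2 C h hh hsurj _ IH x.
  have [y yx] : exists y : 'I_n -> B, h \o y = x.
    exists (fun i => projT1 (cid (hsurj (x i)))).
    by apply/funext => i /=; case: cid.
  by rewrite -yx -!hom_term_fun // IH.
- by move=> d1 B d2 C h hh hinj _ IH x; apply: hinj; rewrite !hom_term_fun // IH.
- move=> I dF F d' C p ph pbij _ IH x; apply: (bij_inj pbij).
  by apply: functional_extensionality_dep => i; rewrite !hom_term_fun // IH.
Qed.

End Identities.

(** * Morphisms and homomorphisms as two-valued maps *)

Section DualityForK.
Context d (X : finOckhamSpaceType d) (x0 : X).
Context (x0_generates : forall x : X, exists k : nat, x = iter k og x0).
Context (og_homo : {homo @og d X : x y / x <= y}).
Local Notation M := (K_alter_ego x0 og_homo).

Definition at_gen (a : K X) : bool := val a x0.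

Lemma at_genU a b : at_gen (a `|` b) = at_gen a || at_gen b.
Proof. by []. Qed.

Lemma at_genI a b : at_gen (a `&` b) = at_gen a && at_gen b.
Proof. by []. Qed.

Lemma iter_og_homo k : {homo iter k (@og d X) : x y / x <= y}.
Proof. by elim: k => //= k IH x y /IH /og_homo. Qed.

Lemma K_ext (a b : K X) :
  (forall k, val a (iter k og x0) = val b (iter k og x0)) -> a = b.
Proof.
move=> ab; apply: val_inj; apply/funext => x.
by have [k ->] := x0_generates x; exact: ab.
Qed.

Lemma val_iter_u k (a : K X) x :
  val (iter k (K_u og_homo) a) x = val a (iter k og x).
Proof. by elim: k x => [//|k IH x]; rewrite [LHS]IH -iterSr. Qed.

Lemma val_iter_ock k (a : K X) x :
  val (iter k ock a) x = odd k (+) val a (iter k og x).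
Proof.
elim: k x => [//|k IH x]; rewrite -[LHS]/(~~ val (iter k ock a) (og x)).
by rewrite IH -iterSr addNb.
Qed.

(** The reversal of the order at odd exponents cancels the negation that each
    application of [ock] introduces. *)
Lemma alternatingP (a b : K X) : alternating x0 a b <->
  forall k, at_gen (iter k ock a) -> at_gen (iter k ock b).
Proof.
have parityP (o p q : bool) : ((~~ o -> p <= q) /\ (o -> q <= p)) <->
    (o (+) p -> o (+) q).
  by case: o; case: p; case: q; rewrite ?leEbool /=;
    (split=> [[h1 h2] h3|h]; [|split=> h']) => //;
    first [exact: h1|exact: h2|exact: h].
by split=> ab k; have := ab k; rewrite /at_gen !val_iter_ock => /parityP.
Qed.

Lemma morphism_comp (Y Z T : tstruct) (phi : Y -> Z) (psi : Z -> T) :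
  morphism phi -> morphism psi -> morphism (psi \o phi).
Proof.
move=> [cphi uphi rphi] [cpsi upsi rpsi]; split.
- by move=> y; apply: continuous_comp; [exact: cphi|exact: cpsi].
- by move=> y /=; rewrite uphi upsi.
- by move=> y y' /rphi/rpsi.
Qed.

Lemma morphism_iter_sop (Y Z : tstruct) (phi : Y -> Z) k y :
  morphism phi -> phi (iter k (@sop Y) y) = iter k (@sop Z) (phi y).
Proof. by move=> [_ u _]; elim: k => //= k <-; exact: u. Qed.

Lemma morphism_ext (Z : tstruct) (alpha beta : Z -> K X) :
  morphisms M alpha -> morphisms M beta ->
  (forall z, at_gen (alpha z) = at_gen (beta z)) -> alpha = beta.
Proof.
move=> ma mb ab; apply/funext => z; apply: K_ext => k.
rewrite -!val_iter_u.
rewrite -[iter k _ (alpha z)](morphism_iter_sop k z ma).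
by rewrite -[iter k _ (beta z)](morphism_iter_sop k z mb); exact: ab.
Qed.

Lemma hom_ext d' (B : ockhamType d') (h h' : B -> K X) :
  ockham_hom h -> ockham_hom h' ->
  (forall b, at_gen (h b) = at_gen (h' b)) -> h = h'.
Proof.
move=> [_ _ _ _ hf] [_ _ _ _ hf'] hh'; apply/funext => b; apply: K_ext => k.
apply: (@addbI (odd k)); rewrite -!val_iter_ock.
have iterh (g : B -> K X) : {morph g : x / ock x} -> iter k ock (g b) = g (iter k ock b).
  by move=> gf; elim: k => //= k ->.
by rewrite !iterh //; exact: hh'.
Qed.

Lemma closed_at_gen (Z : tstruct) (alpha : Z -> K X) (b : bool) :
  morphisms M alpha -> closed [set z | at_gen (alpha z) = b].
Proof.
move=> [ca _ _].
apply: (@preimage_closed _ (discrete_topology (K X)) alpha [set a | at_gen a = b]).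
  by move=> z _; exact: ca.
exact: discrete_closed.
Qed.

(** By [morphism_ext] it is enough to find [s] in [S] that agrees with [alpha] at
    [x0], that is, to express one clopen up-set through the clopen up-sets given
    by [S]. If [alpha] is true at [z] and false at [w], then [z] is not related
    to [w], so some member of [S] is true at [z] and false at [w]. Compactness
    in [w] combines these by finite meets into a member true at [z] and below
    [alpha]; compactness in [z] combines the latter by finite joins. *)
Lemma separating_subuniverse (Z : tstruct) (S : set (Z -> K X)) :
  compact [set: Z] -> subuniverse S -> S `<=` @morphisms _ _ M Z ->
  (forall z z', (forall s, S s -> alternating x0 (s z) (s z')) -> srel z z') ->
  @morphisms _ _ M Z `<=` S.
Proof.
move=> cZ [SU SI S0 S1 Sf] Smor Ssep alpha malpha.
have Siter k s : S s -> S (fun z => iter k ock (s z)).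
  by move=> Ss; elim: k => [//|k]; exact: Sf.
have above z : at_gen (alpha z) -> exists s,
    [/\ S s, at_gen (s z) & forall w, at_gen (s w) -> at_gen (alpha w)].
  move=> az; apply: contrapT => nos.
  have [|||w wP] := @compact_filter_base _ _
    [set s : Z -> K X | S s /\ at_gen (s z)]
    (fun s => [set w | at_gen (s w) = true] `&` [set w | at_gen (alpha w) = false])%classic
    cZ.
  - by exists \top.
  - move=> s [Ss sz]; split.
      by apply: closedI; apply: closed_at_gen => //; exact: Smor.
    apply: contrapT => nw; apply: nos; exists s; split=> // w sw.
    by apply: contrapT => naw; apply: nw; exists w; split=> //; exact/negbTE/negP.
  - move=> s t [Ss sz] [St tz]; exists (s `&` t).
      by split; [exact: SI|rewrite meetfE at_genI sz].
    by move=> w [/=]; rewrite meetfE at_genI => /andP[sw tw] aw.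
  have [|_ aw] := wP \top; first by split.
  have : ~ srel z w.
    have [_ _ ra] := malpha.
    by move=> /ra/alternatingP/(_ 0)/(_ az); rewrite /= aw.
  apply; apply: Ssep => s Ss; apply/alternatingP => k sz.
  by have [] := wP _ (conj (Siter k s Ss) sz).
have [s [Ss sa] as_] : exists2 s, S s /\ (forall w, at_gen (s w) ->
  at_gen (alpha w)) & (forall w, at_gen (alpha w) -> at_gen (s w)).
  apply: contrapT => nos.
  have [|||w wP] := @compact_filter_base _ _
    [set s : Z -> K X | S s /\ forall w, at_gen (s w) -> at_gen (alpha w)]
    (fun s => [set w | at_gen (s w) = false] `&` [set w | at_gen (alpha w) = true])%classic
    cZ.
  - by exists \bot.
  - move=> s [Ss sa]; split.
      by apply: closedI; apply: closed_at_gen => //; exact: Smor.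
    apply: contrapT => nw; apply: nos; exists s => // w aw.
    by apply: contrapT => nsw; apply: nw; exists w; split=> //; exact/negbTE/negP.
  - move=> s t [Ss sa] [St ta]; exists (s `|` t).
      split; first exact: SU.
      by move=> w; rewrite joinfE at_genU => /orP[/sa|/ta].
    by move=> w [/=]; rewrite joinfE at_genU => /negbT/norP[/negbTE sw /negbTE tw] aw.
  have [|_ aw] := wP \bot; first by split.
  have [s [Ss sw sa]] := above w aw.
  by have [] := wP s (conj Ss sa); rewrite /= sw.
suff -> : alpha = s by [].
apply: morphism_ext => //; first exact: Smor.
by move=> z; apply/idP/idP; [exact: as_|exact: sa].
Qed.


(** * Lifting lattice homomorphisms *)

Section LatticeHomomorphisms.
Context d' (B : ockhamType d').
Implicit Types (y : B -> bool) (b c : B).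

Definition signed_value y k b : bool := odd k (+) y (iter k ock b).

Lemma iter_ockU k b c : iter k ock (b `|` c) =
  if odd k then iter k ock b `&` iter k ock c else iter k ock b `|` iter k ock c.
Proof. by elim: k => //= k ->; case: (odd k); rewrite /= ?ockU ?ockI. Qed.

Lemma iter_ockI k b c : iter k ock (b `&` c) =
  if odd k then iter k ock b `|` iter k ock c else iter k ock b `&` iter k ock c.
Proof. by elim: k => //= k ->; case: (odd k); rewrite /= ?ockU ?ockI. Qed.

Lemma iter_ock0 k : iter k ock (\bot : B) = if odd k then \top else \bot.
Proof. by elim: k => //= k ->; case: (odd k); rewrite /= ?ock0 ?ock1. Qed.

Lemma iter_ock1 k : iter k ock (\top : B) = if odd k then \bot else \top.
Proof. by elim: k => //= k ->; case: (odd k); rewrite /= ?ock0 ?ock1. Qed.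

Lemma signed_value_hom y k : two_hom y -> two_hom (signed_value y k).
Proof.
move=> [yU yI y0 y1]; rewrite /signed_value; split=> [b c|b c||].
- by rewrite iter_ockU; case: (odd k); rewrite ?yU ?yI //= negb_and.
- by rewrite iter_ockI; case: (odd k); rewrite ?yU ?yI //= negb_or.
- by rewrite iter_ock0; case: (odd k); rewrite ?y0 ?y1.
- by rewrite iter_ock1; case: (odd k); rewrite ?y0 ?y1.
Qed.

End LatticeHomomorphisms.

Definition ock_term k : term 1 := iter k (@TOck 1) (TVar ord0).

Lemma ock_termE k d' (B : ockhamType d') (x : 'I_1 -> B) :
  term_fun (ock_term k) x = iter k ock (x ord0).
Proof. by elim: k => //= k <-. Qed.

(** The inequality forced by g^k(x0) <= g^l(x0) on the signed terms f^k and f^l,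
    where an odd power stands for its complement: the complement is not a term,
    so for mixed parities the inequality says that f^k and f^l are disjoint, or
    that their join is the top. *)
Definition order_identity k l : term 1 * term 1 :=
  match odd k, odd l with
  | false, false => (TMeet (ock_term k) (ock_term l), ock_term k)
  | false, true => (TMeet (ock_term k) (ock_term l), TBot 1)
  | true, false => (TJoin (ock_term k) (ock_term l), TTop 1)
  | true, true => (TJoin (ock_term k) (ock_term l), ock_term k)
  end.

Lemma K_order_identity k l : iter k og x0 <= iter l og x0 ->
  forall x : 'I_1 -> K X,
  term_fun (order_identity k l).1 x = term_fun (order_identity k l).2 x.
Proof.
move=> kl x; apply: K_ext => j.
have vk i : val (term_fun (ock_term i) x) (iter j og x0) =
    odd i (+) val (x ord0) (iter j og (iter i og x0)).
  by rewrite ock_termE val_iter_ock -!iterD addnC.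
have x_homo : {homo val (x ord0) : u v / u <= v} := set_mem (valP (x ord0)).
have := x_homo _ _ (iter_og_homo j kl).
rewrite leEbool /order_identity; move: (vk k) (vk l).
case: (odd k); case: (odd l) => /= kE lE;
  rewrite ?joinfE ?meetfE kE lE; by do 2!case: (sval (x ord0) _).
Qed.

(** The exponent that represents a point of [X] is chosen arbitrarily;
    [signed_value_eq] makes the lift independent of the choice. *)
Section Lift.
Context d' (B : ockhamType d') (y : B -> bool).
Context (varB : variety (K X) B) (y_hom : two_hom y).

Lemma signed_value_homo k l b : iter k og x0 <= iter l og x0 ->
  signed_value y k b <= signed_value y l b.
Proof.
move=> kl; have := variety_identity (K_order_identity kl) varB (fun=> b).
move=> /(congr1 y); have [yU yI y0 y1] := y_hom.
rewrite /order_identity /signed_value leEbool.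
case: (odd k); case: (odd l) => /=; rewrite ?(yU, yI, y0, y1) !ock_termE /=;
  do 2!case: (y _) => //.
Qed.

Lemma signed_value_eq k l b : iter k og x0 = iter l og x0 ->
  signed_value y k b = signed_value y l b.
Proof. by move=> kl; apply: le_anti; rewrite !signed_value_homo ?kl. Qed.

Let exponent x : nat := projT1 (cid (x0_generates x)).

Let exponentK x : iter (exponent x) og x0 = x.
Proof. by rewrite /exponent; case: cid. Qed.

Lemma lift_subproof b :
  (fun x => signed_value y (exponent x) b) \in @order_preserving _ X.
Proof.
by apply/mem_set => x x' xx'; apply: signed_value_homo; rewrite !exponentK.
Qed.

Definition lift b : K X :=
  exist (fun a => a \in @order_preserving _ X) _ (lift_subproof b).

Lemma lift_hom : ockham_hom lift.
Proof.
split=> [b c|b c|||b]; apply: val_inj; apply/funext => x;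
  have [yU yI y0 y1] := signed_value_hom (exponent x) y_hom.
- exact: yU.
- exact: yI.
- exact: y0.
- exact: y1.
- have -> : val (lift (ock b)) x = ~~ signed_value y (exponent x).+1 b.
    by rewrite /= /signed_value -iterSr /= addNb negbK.
  congr negb; apply: signed_value_eq.
  by rewrite /= !exponentK.
Qed.

Lemma at_gen_lift b : at_gen (lift b) = y b.
Proof.
rewrite -[RHS]/(signed_value y 0 b).
by apply: signed_value_eq; rewrite exponentK.
Qed.

End Lift.

(** * Structures in the class generated by the alter ego *)

Lemma compact_K : compact [set: discrete_topology (K X)].
Proof.
apply: finite_compact.
pose f (a : K X) := [ffun x => val a x].
rewrite -[setT]/(f @^-1` setT); apply: finite_preimage; last exact: finite_finset.
move=> a b _ _ /ffunP ab; apply: val_inj; apply/funext => x.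
by have := ab x; rewrite !ffunE.
Qed.

Lemma compact_substruct (S : Type) (W : set (power S M)) (hW : sop_closed W) :
  closed W -> compact [set: substruct hW].
Proof.
move=> clW; apply: compact_subspace; apply: subclosed_compact clW _ (@subsetT _ _).
by apply: compact_power; exact: compact_K.
Qed.

Lemma compact_IScP (Z : tstruct) : IScP M Z -> compact [set: Z].
Proof.
move=> [S [W [hW [phi [_ clW [_ [psi [[cpsi _ _] phiK _]]]]]]]].
have -> : [set: Z] = psi @` setT.
  by apply/seteqP; split=> // z _; exists (phi z).
apply: continuous_compact; first exact: continuous_subspaceT.
exact: compact_substruct.
Qed.

Lemma morphism_coord (S : Type) (W : set (power S M)) (hW : sop_closed W) s :
  morphisms M (fun z : substruct hW => val z s).
Proof.
split=> [z|//|z z' zz']; last exact: zz'.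
exact: (continuous_comp (@initial_continuous _ _ (val : set_type W -> power S M) z)
  (@continuous_coord S M s (val z))).
Qed.

(** The coordinates of an embedding into a power determine everything about [Z]
    that the arguments below need: its relation, its points and its topology. *)
Lemma IScP_coordinates (Z : tstruct) : IScP M Z ->
  exists (S : Type) (c : S -> Z -> K X), [/\ forall s, morphisms M (c s),
    forall z z', (forall s, alternating x0 (c s z) (c s z')) -> srel z z',
    forall z z', (forall s, c s z = c s z') -> z = z' &
    forall (T : topologicalType) (f : T -> Z),
      (forall s, continuous (c s \o f : T -> M)) -> continuous f].
Proof.
move=> [S [W [hW [phi [_ _ [mphi [psi [mpsi phiK psiK]]]]]]]].
exists S, (fun s z => val (phi z) s); split.
- by move=> s; exact: (@morphism_comp Z (substruct hW) M _ _ mphi (morphism_coord hW s)).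
- by move=> z z' zz'; rewrite -(phiK z) -(phiK z'); case: mpsi => _ _; exact.
- by move=> z z' zz'; apply: (can_inj phiK); apply: val_inj; apply/funext.
- move=> T f fc.
  have -> : f = psi \o (phi \o f) by apply/funext => t /=; rewrite phiK.
  have cphif : continuous (phi \o f).
    apply: (@continuous_comp_initial _ _ _ (val : set_type W -> power S M)).
    by apply: continuous_pointwise => s; exact: fc.
  by move=> t; apply: continuous_comp; [exact: cphif|case: mpsi => + _ _; exact].
Qed.

(** * Duality *)

Section DualOfAlgebra.
Context d' (B : ockhamType d').

Lemma near_coord (x : power B M) b : \forall y \near x, y b = x b.
Proof.
by apply: (@continuous_coord B M b x [set a | a = x b]); exact: discrete_set1.
Qed.

(** Each defining condition of a homomorphism involves at most three coordinates,
    and a limit of homomorphisms agrees with one of them on any three. *)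
Lemma closed_homs : closed (@homs _ _ M _ B).
Proof.
move=> x clx.
have agree (a b c : B) : exists2 h : B -> K X, ockham_hom h &
    [/\ h a = x a, h b = x b & h c = x c].
  have nx : nbhs x [set y | [/\ y a = x a, y b = x b & y c = x c]].
    by apply: filterS3 (near_coord x a) (near_coord x b) (near_coord x c).
  by have [h [hh hx]] := clx _ nx; exists h.
split=> [a b|a b|||b].
- by have [h [hU _ _ _ _] [<- <- <-]] := agree (a `|` b) a b.
- by have [h [_ hI _ _ _] [<- <- <-]] := agree (a `&` b) a b.
- by have [h [_ _ h0 _ _] [<- _ _]] := agree \bot \bot \bot.
- by have [h [_ _ _ h1 _] [<- _ _]] := agree \top \top \top.
- by have [h [_ _ _ _ hf] [<- <- _]] := agree (ock b) b b.
Qed.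

Lemma eval_algebra_hom : ockham_hom (@eval_algebra _ _ M _ B).
Proof.
split=> [a b|a b|||b]; apply: val_inj; apply/funext => x;
  have [xU xI xb xt xf] := set_mem (valP x).
- exact: xU.
- exact: xI.
- exact: xb.
- exact: xt.
- exact: xf.
Qed.

Context (varB : variety (K X) B).

Lemma eval_algebra_inj : injective (@eval_algebra _ _ M _ B).
Proof.
suff le_eval (b c : B) : eval_algebra M b = eval_algebra M c -> b <= c.
  by move=> b c bc; apply: le_anti; rewrite !le_eval.
move=> bc; apply/negPn/negP => /prime_filter[y [y_hom yb yc]].
pose x : dual_struct M B :=
  exist (fun h => h \in @homs _ _ M _ B) _ (mem_set (lift_hom varB y_hom)).
have /(congr1 at_gen) : val x b = val x c := congr1 (fun e => val e x) bc.
by rewrite !at_gen_lift yb yc.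
Qed.

(** The evaluation maps detect the relation of D(B) because that relation is
    defined coordinatewise. *)
Lemma eval_algebra_surj (alpha : dual_algebra M (dual_struct M B)) :
  exists b, eval_algebra M b = alpha.
Proof.
pose S := [set (fun x : dual_struct M B => val x b : K X) | b in [set: B]].
have eval_hom (x : dual_struct M B) := set_mem (valP x).
have [] : S (val alpha); last first.
  by move=> b _ ba; exists b; apply: val_inj.
apply: (@separating_subuniverse (dual_struct M B)).
- exact: compact_substruct closed_homs.
- split=> [_ _ [a _ <-] [b _ <-]|_ _ [a _ <-] [b _ <-]|||_ [b _ <-]].
  + by exists (a `|` b) => //; apply/funext => x; case: (eval_hom x).
  + by exists (a `&` b) => //; apply/funext => x; case: (eval_hom x).
  + by exists \bot => //; apply/funext => x; case: (eval_hom x).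
  + by exists \top => //; apply/funext => x; case: (eval_hom x).
  + by exists (ock b) => //; apply/funext => x; case: (eval_hom x).
- by move=> _ [b _ <-]; exact: morphism_coord.
- by move=> x x' xx' b; apply: (xx' (fun x => val x b)); exists b.
- exact: set_mem (valP alpha).
Qed.

End DualOfAlgebra.

Lemma duality : yields_duality M.
Proof.
move=> d' B varB; split; first exact: eval_algebra_hom.
have eval_surj := eval_algebra_surj (B := B).
exists (fun alpha => projT1 (cid (eval_surj alpha))) => [b|alpha];
  case: cid => //= c; exact: eval_algebra_inj.
Qed.

(** * Fullness *)

Section DualOfStructure.
Context (Z : tstruct) (Z_IScP : IScP M Z).

Lemma eval_struct_morphism : morphism (@eval_struct _ _ M Z).
Proof.
split=> [|z|z z' zz' alpha].
- apply: (@continuous_comp_initial _ _ _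
    (val : set_type (@homs _ _ M _ (dual_algebra M Z)) -> power (dual_algebra M Z) M)).
  apply: continuous_pointwise => alpha.
  by have [] := set_mem (valP alpha).
- apply: val_inj; apply/funext => alpha.
  by have [_ + _] := set_mem (valP alpha); exact.
- by have [_ _] := set_mem (valP alpha); exact.
Qed.

(** A pair (a, b) with [x] true at [a] and false at [b] asks for a point [z] with
    [a z] true and [b z] false. Each request can be met, since otherwise [a]
    would lie below [b] in E(Z), and two requests combine into one through the
    meet of the first and the join of the second components; by compactness
    some [z] meets them all, and evaluation at [z] is [x]. *)
Lemma eval_struct_surj (x : dual_struct M (dual_algebra M Z)) :
  exists z, eval_struct M z = x.
Proof.
have x_hom : ockham_hom (val x : _ -> K X) := set_mem (valP x).
have [xU xI xb xt xf] := x_hom.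
pose y (alpha : dual_algebra M Z) := at_gen (val x alpha).
have mor (alpha : dual_algebra M Z) : morphisms M (val alpha) := set_mem (valP alpha).
have [|||z zP] := @compact_filter_base Z _
  [set ab : dual_algebra M Z * dual_algebra M Z | y ab.1 = true /\ y ab.2 = false]
  (fun ab => [set z | at_gen (val ab.1 z) = true] `&`
             [set z | at_gen (val ab.2 z) = false])%classic
  (compact_IScP Z_IScP).
- by exists (\top, \bot); split; rewrite /y /= ?xt ?xb.
- move=> [a b] [/= ya yb]; split.
    exact: closedI (closed_at_gen (mor a)) (closed_at_gen (mor b)).
  apply: contrapT => nz.
  have ab : a = a `&` b.
    apply: val_inj; apply: (morphism_ext (mor a) (mor (a `&` b))) => z.
    have [_ evI _ _ _] := set_mem (eval_struct_subproof M z).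
    have -> : val (a `&` b) z = val a z `&` val b z := evI a b.
    rewrite at_genI.
    case az: (at_gen (val a z)) => //; case bz: (at_gen (val b z)) => //.
    by case: nz; exists z.
  by move: ya; rewrite ab /y xI at_genI -/(y b) yb andbF.
- move=> [a b] [a' b'] [/= ya yb] [/= ya' yb'].
  exists (a `&` a', b `|` b').
    by split; rewrite /y /= ?xI ?xU ?at_genI ?at_genU -/(y _) -/(y _) ?ya ?ya' ?yb ?yb'.
  by move=> z [/= /andP[az az'] /negbT/norP[/negbTE bz /negbTE bz']].
have ev_hom := set_mem (eval_struct_subproof M z).
exists z; apply: val_inj; apply: (hom_ext ev_hom x_hom) => alpha.
rewrite -/(y alpha).
case ya: (y alpha).
  by have [|] := zP (alpha, \bot); first by split; rewrite /= /y ?xb.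
by have [|] := zP (\top, alpha); first by split; rewrite /= /y ?xt.
Qed.

(** The coordinates of [Z] are themselves elements of E(Z), so the coordinates of
    the inverse of the evaluation map are evaluations, hence continuous and
    relation-preserving. *)
Lemma eval_struct_iso : struct_iso (@eval_struct _ _ M Z).
Proof.
have [S [c [c_mor c_rel c_inj c_cont]]] := IScP_coordinates Z_IScP.
pose gamma s : dual_algebra M Z := exist _ (c s) (mem_set (c_mor s)).
pose psi x := projT1 (cid (eval_struct_surj x)).
have psiK : cancel psi (@eval_struct _ _ M Z) by move=> x; rewrite /psi; case: cid.
have c_psi s x : c s (psi x) = val x (gamma s) by rewrite -[in RHS](psiK x).
have evalK : cancel (@eval_struct _ _ M Z) psi.
  by move=> z; apply: c_inj => s; rewrite c_psi.
split; first exact: eval_struct_morphism.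
exists psi; split=> //; split.
- apply: c_cont => s; rewrite (_ : _ \o _ = fun x => val x (gamma s)); last first.
    by apply/funext => x; exact: c_psi.
  by have [] := morphism_coord (@homs_sop_closed _ _ M _ (dual_algebra M Z)) (gamma s).
- move=> x; apply: (can_inj evalK); rewrite psiK.
  by have [_ -> _] := eval_struct_morphism; rewrite psiK.
- by move=> x x' xx'; apply: c_rel => s; rewrite !c_psi; exact: xx'.
Qed.

End DualOfStructure.

(** * Injectivity and interpolation *)

(** The morphisms on [Y] that extend along [phi] form a subuniverse, and they
    detect the relation because [Y] carries the relation induced from [Z]. *)
Lemma alter_ego_injective : injective_in_IScP M.
Proof.
move=> Y Z Y_IScP Z_IScP phi alpha [mphi [W [hW [psi]]]].
move=> [_ [_ [chi [mchi psiK _]]] phiE] malpha.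
have [S [c [c_mor c_rel _ _]]] := IScP_coordinates Z_IScP.
have [ZU ZI Z0 Z1 Zf] := morphisms_subuniverse M Z.
have [] : [set gamma \o phi | gamma in @morphisms _ _ M Z] alpha; last first.
  by move=> beta mbeta <-; exists beta.
apply: (@separating_subuniverse Y) malpha; first exact: compact_IScP.
- split=> [_ _ [a ma <-] [b mb <-]|_ _ [a ma <-] [b mb <-]|||_ [a ma <-]].
  + by exists (a `|` b); first exact: ZU.
  + by exists (a `&` b); first exact: ZI.
  + by exists \bot.
  + by exists \top.
  + by exists (ock a); first exact: Zf.
- by move=> _ [a ma <-]; exact: (@morphism_comp Y Z M _ _ mphi ma).
- move=> y y' yy'; rewrite -(psiK y) -(psiK y').
  have [_ _] := mchi; apply; rewrite /= -!phiE; apply: c_rel => s.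
  by apply: (yy' (c s \o phi)); exists (c s).
Qed.

(** The variables, as term functions, already detect the relation of a power of
    the alter ego. *)
Lemma term_interpolation : interpolation M.
Proof.
move=> n _ Z hZ alpha malpha.
pose tf (t : term n) (z : substruct hZ) : K X := term_fun t (val z : 'I_n -> K X).
have [] : [set tf t | t in [set: term n]] alpha; last first.
  by move=> t _ <-; exists t.
have [ZU ZI Z0 Z1 Zf] := morphisms_subuniverse M (substruct hZ).
apply: (@separating_subuniverse (substruct hZ)) malpha.
- apply: finite_compact.
  pose f (z : substruct hZ) := [ffun i => [ffun x => val ((val z : 'I_n -> K X) i) x]].
  rewrite -[setT]/(f @^-1` setT); apply: finite_preimage; last exact: finite_finset.
  move=> z z' _ _ /ffunP zz'; apply: val_inj; apply/funext => i.
  apply: val_inj; apply/funext => x.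
  by have := zz' i; rewrite !ffunE => /ffunP/(_ x); rewrite !ffunE.
- split=> [_ _ [s _ <-] [t _ <-]|_ _ [s _ <-] [t _ <-]|||_ [t _ <-]].
  + by exists (TJoin s t).
  + by exists (TMeet s t).
  + by exists (TBot n).
  + by exists (TTop n).
  + by exists (TOck t).
- move=> _ [t _ <-]; elim: t => [i|s IHs t IHt|s IHs t IHt|t IHt||].
  + exact: morphism_coord.
  + exact: ZU IHs IHt.
  + exact: ZI IHs IHt.
  + exact: Zf IHt.
  + exact: Z0.
  + exact: Z1.
- by move=> z z' zz' i; apply: (zz' (tf (TVar i))); exists (TVar i).
Qed.

End DualityForK.

Theorem theorem5p4 (d : Order.disp_t) (X : finOckhamSpaceType d) (x0 : X)
    (x0_generates : forall x : X, exists k : nat, x = iter k og x0)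
    (og_homo : {homo @og d X : x y / (x <= y)%O}) :
  yields_strong_duality (K_alter_ego x0 og_homo) /\
  interpolation (K_alter_ego x0 og_homo).
Proof.
split; last exact: term_interpolation.
split; last exact: alter_ego_injective.
by split; [exact: duality|move=> Z; exact: eval_struct_iso].
Qed.
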